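(* Let $p,q,r$ be pairwise relatively prime integers with $1<p<q<r$, and let $N_0=pqr-pq-pr-qr$. Then $\kappa(p,q,r)$ is equal to the number of lattice points (points of $\mathbb{Z}^3$) inside the (closed) tetrahedron with vertices $(0,0,0)$, $(N_0/pq,0,0)$, $(0,N_0/pr,0)$ and $(0,0,N_0/qr)$ (interpreted as the empty set if $N_0<0$). In other words, $\kappa(p,q,r)$ equals the cardinality of the set $G\cap[0,N_0]$, where $G=G(pq,pr,qr)$ is the numerical semigroup generated by $0$, $pq$, $qr$ and $pr$.
   Context: Let $(e_0,p',q',r')$ be the unique integers with $e_0pqr+p'qr+pq'r+pqr'=-1$, $1\le p'\le p-1$, $1\le q'\le q-1$, $1\le r'\le r-1$. Define $$\Delta(n)=1+|e_0|n-\left\lceil\frac{np'}{p}\right\rceil-\left\lceil\frac{nq'}{q}\right\rceil-\left\lceil\frac{nr'}{r}\right\rceil\quad(n\in\mathbb{Z}_{\ge0}),\qquad \kappa(p,q,r)=\left|\sum_{n=0}^\infty\min\{0,\Delta(n)\}\right| .$$ This is the kappa invariant of the Brieskorn sphere $\varSigma(p,q,r)$. Points on the boundary of the tetrahedron are counted. *)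

(* Defs.v *)
From HB Require Import structures.
From mathcomp Require Import all_boot all_order all_algebra.
From mathcomp Require Import ring lra zify.
From mathcomp Require Import mathcomp_extra boolp classical_sets functions.
From mathcomp Require Import cardinality fsbigop set_interval reals.

Set Implicit Arguments.
Unset Strict Implicit.
Unset Printing Implicit Defensive.

Import Order.TTheory GRing.Theory Num.Theory.
Local Open Scope classical_set_scope.
Local Open Scope ring_scope.

Definition is_seifert (p q r : int) : set (int * int * int * int) :=
  [set s | let: (e0, p', q', r') := s in
    [/\ e0 * p * q * r + p' * q * r + p * q' * r + p * q * r' = -1,
        1 <= p' <= p - 1, 1 <= q' <= q - 1 & 1 <= r' <= r - 1]].

(* The default value is never used for pairwise coprime p, q, r > 1:
   see [is_seifert_ex] and [is_seifert_uniq]. *)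
Definition seifert (p q r : int) : int * int * int * int :=
  xget (0, 0, 0, 0) (is_seifert p q r).

Definition Delta (p q r : int) (n : nat) : int :=
  let: (e0, p', q', r') := seifert p q r in
  1 + `|e0| * n%:Z
  - Num.ceil ((n%:Z * p')%:Q / p%:Q)
  - Num.ceil ((n%:Z * q')%:Q / q%:Q)
  - Num.ceil ((n%:Z * r')%:Q / r%:Q).

(* A sum with only finitely many nonzero terms: see [finite_support_Delta]. *)
Definition kappa (p q r : int) : nat :=
  `|(\sum_(n \in [set: nat]) Num.min 0 (Delta p q r n))%R|%N.

Definition N0 (p q r : int) : int := p * q * r - p * q - p * r - q * r.

Definition convex_hull (R : numDomainType) (V : lmodType R) (s : seq V) : set V :=
  [set \sum_(i < size s) t i *: s`_i | t in
    [set t : nat -> R | (forall i, 0 <= t i) /\ \sum_(i < size s) t i = 1]].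

Definition tetrahedron (R : realType) (p q r : int) : set 'rV[R]_3 :=
  let N := N0 p q r in
  if N < 0 then set0 else
  convex_hull [:: 0;
    (N%:~R / (p * q)%:~R) *: 'e_0;
    (N%:~R / (p * r)%:~R) *: 'e_1;
    (N%:~R / (q * r)%:~R) *: 'e_2%:R].

Arguments tetrahedron : clear implicits.

Definition lattice_points (R : realType) (A : set 'rV[R]_3) : set 'rV[int]_3 :=
  [set z | A (map_mx intr z)].

Definition semigroup_generated (S : set int) : set int :=
  smallest [set A | forall x y, A x -> A y -> A (x + y)] S.

Definition G (a b c : int) : set int := semigroup_generated [set 0; a; b; c].

Lemma seifert_residue (a b : int) : 1 < a -> coprimez a b ->
  exists2 x : int, 1 <= x <= a - 1 & (a %| (1 + x * b)%R)%Z.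
Proof.
move=> a1 cab; have [u [v uv]] := Bezoutz a b.
have uv1 : u * a + v * b = 1 by rewrite uv; apply/eqP; exact: cab.
have a0 : a != 0 by rewrite gt_eqF //; lia.
exists ((- v) %% a)%Z; last first.
  apply/dvdzP; exists (u - ((- v) %/ a)%Z * b).
  have E := divz_eq (- v) a.
  have -> : ((- v) %% a)%Z = - v - ((- v) %/ a)%Z * a by rewrite {2}E; ring.
  rewrite -uv1; ring.
have h0 := modz_ge0 (- v) a0.
have h1 : ((- v) %% a)%Z < a by apply: ltz_pmod; lia.
suff : ((- v) %% a)%Z != 0 by lia.
apply/eqP => h; have E := divz_eq (- v) a; rewrite h addr0 in E.
have : (a %| 1%R)%Z.
  move: E; set k := ((- v) %/ a)%Z => E.
  apply/dvdzP; exists (u - k * b).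
  rewrite -uv1; have -> : u * a + v * b = u * a - (- v) * b by ring.
  rewrite E; ring.
rewrite dvdz1; lia.
Qed.

Lemma dvdz_small (a x y : int) : 1 <= x <= a - 1 -> 1 <= y <= a - 1 ->
  (a %| x - y)%Z -> x = y.
Proof.
move=> hx hy /dvdzP[k hk].
have [k0|[k0|k0]] : k = 0 \/ (1 <= k \/ k <= -1) by lia.
- by rewrite k0 mul0r in hk; lia.
- have : 0 <= (k - 1) * a by apply: mulr_ge0; lia.
  by rewrite mulrBl -hk; lia.
- have : 0 <= (- k - 1) * a by apply: mulr_ge0; lia.
  by rewrite mulrBl mulNr -hk; lia.
Qed.

Section Seifert.
Variables p q r : int.
Hypotheses (p1 : 1 < p) (q1 : 1 < q) (r1 : 1 < r).
Hypotheses (pq : coprimez p q) (pr : coprimez p r) (qr : coprimez q r).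

Lemma is_seifert_ex : exists s, is_seifert p q r s.
Proof.
have cp : coprimez p (q * r) by rewrite coprimezMr pq pr.
have cq : coprimez q (p * r) by rewrite coprimezMr coprimez_sym pq qr.
have cr : coprimez r (p * q).
  by rewrite coprimezMr coprimez_sym pr coprimez_sym qr.
have [x xp /dvdzP[kx dx]] := seifert_residue p1 cp.
have [y yq /dvdzP[ky dy]] := seifert_residue q1 cq.
have [z zr /dvdzP[kz dz]] := seifert_residue r1 cr.
have : (p * q * r %| (1 + x * q * r + p * y * r + p * q * z)%R)%Z.
  rewrite Gauss_dvdz; last by rewrite coprimez_sym.
  rewrite Gauss_dvdz //; apply/andP; split; last first.
    apply/dvdzP; exists (kz + x * q + p * y).
    have -> : 1 + x * q * r + p * y * r + p * q * z =
      (1 + z * (p * q)) + (x * q + p * y) * r by ring.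
    by rewrite dz; ring.
  apply/andP; split; apply/dvdzP.
    exists (kx + y * r + q * z).
    have -> : 1 + x * q * r + p * y * r + p * q * z =
      (1 + x * (q * r)) + (y * r + q * z) * p by ring.
    by rewrite dx; ring.
  exists (ky + x * r + p * z).
  have -> : 1 + x * q * r + p * y * r + p * q * z =
    (1 + y * (p * r)) + (x * r + p * z) * q by ring.
  by rewrite dy; ring.
case/dvdzP=> e he; exists (- e, x, y, z); split=> //.
have -> : - e * p * q * r = - (e * (p * q * r)) by ring.
by rewrite -he; ring.
Qed.

Lemma is_seifert_uniq s t :
  is_seifert p q r s -> is_seifert p q r t -> s = t.
Proof.
case: s => [[[e x] y] z]; case: t => [[[e' x'] y'] z'].
case=> E1 hx hy hz [E2 hx' hy' hz'].
have E : e * p * q * r + x * q * r + p * y * r + p * q * z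
       = e' * p * q * r + x' * q * r + p * y' * r + p * q * z' by rewrite E1 E2.
have xx : x = x'.
  apply: (dvdz_small hx hx').
  rewrite -(@Gauss_dvdzl _ _ (q * r)) ?coprimezMr ?pq //.
  apply/dvdzP; exists (e' * q * r - e * q * r + (y' - y) * r + q * (z' - z)).
  apply/eqP; rewrite -subr_eq0; apply/eqP.
  by rewrite -(subrr (e' * p * q * r + x' * q * r + p * y' * r + p * q * z')) -{1}E; ring.
have yy : y = y'.
  apply: (dvdz_small hy hy').
  rewrite -(@Gauss_dvdzl _ _ (p * r)) ?coprimezMr ?qr ?andbT 1?coprimez_sym //.
  apply/dvdzP; exists (e' * p * r - e * p * r + (x' - x) * r + p * (z' - z)).
  apply/eqP; rewrite -subr_eq0; apply/eqP.
  by rewrite -(subrr (e' * p * q * r + x' * q * r + p * y' * r + p * q * z')) -{1}E; ring.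
have zz : z = z'.
  apply: (dvdz_small hz hz').
  rewrite -(@Gauss_dvdzl _ _ (p * q)); last first.
    by rewrite coprimezMr coprimez_sym pr coprimez_sym qr.
  apply/dvdzP; exists (e' * p * q - e * p * q + (x' - x) * q + p * (y' - y)).
  apply/eqP; rewrite -subr_eq0; apply/eqP.
  by rewrite -(subrr (e' * p * q * r + x' * q * r + p * y' * r + p * q * z')) -{1}E; ring.
move: E; rewrite xx yy zz => E; congr (_, _, _, _).
have n0 : p * q * r != 0 by rewrite !mulf_neq0 // gt_eqF //; lia.
apply: (mulIf n0).
apply: (addIr (x' * q * r + p * y' * r + p * q * z')).
by rewrite !mulrA !addrA.
Qed.

Lemma seifertP : is_seifert p q r (seifert p q r).
Proof. exact: (xgetPex _ is_seifert_ex). Qed.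

Lemma Delta_ge0 (n : nat) : 2 * (p * q * r) <= n%:Z -> 0 <= Delta p q r n.
Proof.
have := seifertP; rewrite /Delta.
case: (seifert p q r) => [[[e x] y] z] [E /andP[x1 _] /andP[y1 _] /andP[z1 _]] hn.
have P0 : 0 < p * q * r by rewrite !mulr_gt0 //; lia.
have e0 : e <= 0.
  rewrite leNgt; apply/negP => e0.
  have : 0 < e * p * q * r by rewrite !mulr_gt0 //; lia.
  have : 0 < x * q * r by rewrite !mulr_gt0 //; lia.
  have : 0 < p * y * r by rewrite !mulr_gt0 //; lia.
  have : 0 < p * q * z by rewrite !mulr_gt0 //; lia.
  lia.
have ceil_le (m a : int) : 1 < a ->
    Num.ceil (m%:Q / a%:Q) * a <= m + a - 1.
  move=> a1; have a0 : (0 : rat) < a%:~R by rewrite ltr0z; lia.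
  have := @ceilB1_lt rat (m%:Q / a%:Q).
  rewrite ltr_pdivlMr // -intrM ltr_int; move: (Num.ceil _) => k.
  by rewrite mulrBl mul1r; move: (k * a) => ka; lia.
set a := Num.ceil _; set b := Num.ceil _; set c := Num.ceil _.
have ha : a * p <= n%:Z * x + p - 1 by exact: ceil_le.
have hb : b * q <= n%:Z * y + q - 1 by exact: ceil_le.
have hc : c * r <= n%:Z * z + r - 1 by exact: ceil_le.
have la : a * p * (q * r) <= (n%:Z * x + p - 1) * (q * r).
  by apply: ler_wpM2r => //; rewrite mulr_ge0 //; lia.
have lb : b * q * (p * r) <= (n%:Z * y + q - 1) * (p * r).
  by apply: ler_wpM2r => //; rewrite mulr_ge0 //; lia.
have lc : c * r * (p * q) <= (n%:Z * z + r - 1) * (p * q).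
  by apply: ler_wpM2r => //; rewrite mulr_ge0 //; lia.
have qr0 : 0 < q * r by rewrite mulr_gt0 //; lia.
have pr0 : 0 < p * r by rewrite mulr_gt0 //; lia.
have pq0 : 0 < p * q by rewrite mulr_gt0 //; lia.
rewrite ler0_norm // -(pmulr_lge0 _ P0).
have nE : n%:Z * (e * p * q * r + x * q * r + p * y * r + p * q * z) = - n%:Z.
  by rewrite E mulrN1.
lia.
Qed.

Lemma finite_support_Delta :
  finite_set [set n | Num.min 0 (Delta p q r n) != 0].
Proof.
apply: (@sub_finite_set _ _ `I_(`|(2 * (p * q * r))%R|%N)); last exact: finite_II.
move=> n /=; apply: contraNltn => hn; apply/eqP/min_idPl/Delta_ge0; lia.
Qed.

End Seifert.

(* Main.v *)
Require Import Defs.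
From mathcomp Require Import all_boot all_order all_algebra.
From mathcomp Require Import ring lra zify fsbigop.
From mathcomp Require Import classical_sets functions cardinality set_interval reals.
Import Order.TTheory GRing.Theory Num.Theory.
Local Open Scope classical_set_scope.
Local Open Scope ring_scope.
Local Open Scope card_scope.

(** Fix [p], [q], [r].  By the Chinese remainder theorem every [n] is uniquely
    [x pq + y pr + z qr + k pqr] with [0 <= x < r], [0 <= y < q], [0 <= z < p].
    Multiplying the Seifert equation by [n] produces this expansion with
    digits [- n r' mod r], [- n q' mod q], [- n p' mod p], which are exactly the
    round-off errors of the three ceilings, so that [Delta n = 1 + k].
    For [n >= 0] this forces [Delta n >= -1], with equality iff
    [N0 - n = (r-1-x) pq + (q-1-y) pr + (p-1-z) qr].  Since nonnegative
    combinations of [pq], [pr], [qr] that are at most [N0 < pqr] have such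
    digits, [n |-> N0 - n] matches the [n] with [Delta n = -1], each of
    which contributes [-1] to the sum, with the combinations in [0, N0]. *)

(** The remainder of this division is the round-off error of the ceiling. *)
Lemma ceil_divzN (m a : int) : 0 < a ->
  Num.ceil (m%:Q / a%:Q) = - ((- m) %/ a)%Z.
Proof.
move=> a0; have a0Q : (0 : rat) < a%:~R by rewrite ltr0z.
apply: ceil_def; rewrite ltr_pdivlMr // ler_pdivrMr // -!intrM ltr_int ler_int.
have := divz_eq (- m) a; have := ltz_pmod (- m) a0.
have := modz_ge0 (- m) (lt0r_neq0 a0).
by rewrite mulrBl mulNr mul1r; move: (_ * a) => ka; lia.
Qed.

Lemma coprimez_cancel_small {d m x y : int} : coprimez d m ->
  0 <= x < d -> 0 <= y < d -> (d %| (x - y) * m)%Z -> x = y.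
Proof.
move=> dm hx hy; rewrite Gauss_dvdzl // -eqz_mod_dvd => /eqP.
by rewrite !modz_small.
Qed.

Definition comb (p q r x y z : int) : int :=
  x * (p * q) + y * (p * r) + z * (q * r).

Lemma G_comb (p q r : int) :
  G (p * q) (p * r) (q * r) =
  [set m | exists x y z : nat, m = comb p q r x y z].
Proof.
apply/seteqP; split=> [m | m [x [y [z ->]]]].
  apply; split=> [_ _ [x [y [z ->]]] [x' [y' [z' ->]]] | _ /= [[[->|->]|->]|->]].
  - by exists (x + x')%N, (y + y')%N, (z + z')%N; rewrite /comb; lia.
  - by exists 0%N, 0%N, 0%N; rewrite /comb; lia.
  - by exists 1%N, 0%N, 0%N; rewrite /comb; lia.
  - by exists 0%N, 1%N, 0%N; rewrite /comb; lia.
  - by exists 0%N, 0%N, 1%N; rewrite /comb; lia.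
move=> A /= [AD AS].
have A0 : A 0 by apply: AS; do 3!left.
have AM (k : nat) a : A a -> A (k%:Z * a).
  move=> Aa; elim: k => [|k IHk]; first by rewrite mul0r.
  by rewrite -addn1 PoszD mulrDl mul1r; exact: AD.
by apply: (AD); [apply: (AD)|]; apply: AM; apply: AS => /=; tauto.
Qed.

Lemma ord3P (j : 'I_3) : [\/ j = 0, j = 1 | j = 2%:R].
Proof.
by case: j => [[|[|[|//]]] j3]; [apply: Or31 | apply: Or32 | apply: Or33];
  apply: val_inj.
Qed.

(** * Digits and lattice points of the tetrahedron *)

Section Brieskorn.
Variables p q r : int.
Hypotheses (p1 : 1 < p) (q1 : 1 < q) (r1 : 1 < r).

Let pq0 : 0 < p * q. Proof. by rewrite mulr_gt0 //; lia. Qed.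
Let pr0 : 0 < p * r. Proof. by rewrite mulr_gt0 //; lia. Qed.
Let qr0 : 0 < q * r. Proof. by rewrite mulr_gt0 //; lia. Qed.

(** Shifting [x] by [r], [y] by [q] or [z] by [p] changes [comb] by [p * q * r], hence these
    ranges. *)
Definition digits (x y z : int) := [/\ 0 <= x < r, 0 <= y < q & 0 <= z < p].

Lemma digits_le_N0 (x y z : int) : 0 <= x -> 0 <= y -> 0 <= z ->
  comb p q r x y z <= N0 p q r -> digits x y z.
Proof.
rewrite /comb /N0 => x0 y0 z0 h.
have hx : 0 <= x * (p * q) by rewrite mulr_ge0 //; lia.
have hy : 0 <= y * (p * r) by rewrite mulr_ge0 //; lia.
have hz : 0 <= z * (q * r) by rewrite mulr_ge0 //; lia.
split; apply/andP; split => //.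
- rewrite -(ltr_pM2r pq0); lia.
- rewrite -(ltr_pM2r pr0); lia.
- rewrite -(ltr_pM2r qr0); lia.
Qed.

(** The weights at the three nonzero vertices, times [N], are the summands of [comb]; the weight at
    the origin takes up the slack in the inequality. *)
Lemma lattice_points_tetrahedron (R : realType) (v : 'rV[int]_3) :
  lattice_points (tetrahedron R p q r) v <->
  [/\ 0 <= v 0 0, 0 <= v 0 1, 0 <= v 0 2%:R &
      comb p q r (v 0 0) (v 0 1) (v 0 2%:R) <= N0 p q r].
Proof.
have pqR : ((p * q)%:~R : R) != 0 by rewrite intr_eq0 lt0r_neq0.
have prR : ((p * r)%:~R : R) != 0 by rewrite intr_eq0 lt0r_neq0.
have qrR : ((q * r)%:~R : R) != 0 by rewrite intr_eq0 lt0r_neq0.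
rewrite /lattice_points /tetrahedron /=.
set N := N0 p q r; set s := [:: _; _; _; _].
have sumE (t : nat -> R) : \sum_(i < size s) t i *: s`_i = map_mx intr v <->
    [/\ t 1%N * N%:~R = (v 0 0 * (p * q))%:~R,
        t 2%N * N%:~R = (v 0 1 * (p * r))%:~R &
        t 3%N * N%:~R = (v 0 2%:R * (q * r))%:~R].
  rewrite /= !big_ord_recl big_ord0 /= scaler0 add0r addr0.
  split=> [E | [Ex Ey Ez]].
    have /= := congr1 (fun M : 'rV[R]_3 => M 0 2%:R) E.
    have /= := congr1 (fun M : 'rV[R]_3 => M 0 1) E.
    have /= := congr1 (fun M : 'rV[R]_3 => M 0 0) E.
    rewrite !mxE /= !(mulr1, mulr0, addr0, add0r) => Ex Ey Ez.
    by split; rewrite intrM -?Ex -?Ey -?Ez mulrA divfK.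
  apply/rowP => j; have [->|->|->] := ord3P j;
    rewrite !mxE /= !(mulr1, mulr0, addr0, add0r).
  - by rewrite mulrA Ex intrM mulfK.
  - by rewrite mulrA Ey intrM mulfK.
  - by rewrite mulrA Ez intrM mulfK.
have [N_lt0|N_ge0] := ltP N 0.
  split=> // -[x0 y0 z0]; suff : 0 <= comb p q r (v 0 0) (v 0 1) (v 0 2%:R) by lia.
  by rewrite !addr_ge0 // mulr_ge0 // ltW.
have N_ge0R : (0 : R) <= N%:~R by rewrite ler0z.
split=> [[t [t_ge0 t_sum]] /sumE[Ex Ey Ez] | [x0 y0 z0 le_N]].
  have coord_ge0 (i : nat) (a m : int) : 0 < m -> t i * N%:~R = (a * m)%:~R -> 0 <= a.
    by move=> m0 tE; rewrite -(pmulr_lge0 _ m0) -(ler0z R) -tE mulr_ge0.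
  split; [exact: coord_ge0 Ex | exact: coord_ge0 Ey | exact: coord_ge0 Ez |].
  rewrite -(ler_int R) 2!intrD -Ex -Ey -Ez -!mulrDl ler_piMl //.
  move: t_sum (t_ge0 0%N); rewrite /= !big_ord_recl big_ord0 /= /bump /=; lra.
(* For [N = 0] division by [N] gives [0], hence the weights of the vertex [0]. *)
pose t := nth (0 : R) [:: 1 - (comb p q r (v 0 0) (v 0 1) (v 0 2%:R))%:~R / N%:~R;
  (v 0 0 * (p * q))%:~R / N%:~R; (v 0 1 * (p * r))%:~R / N%:~R;
  (v 0 2%:R * (q * r))%:~R / N%:~R].
have t_ge0 i : 0 <= t i.
  have [i4|i4] := ltnP i 4; last by rewrite /t nth_default.
  case: i i4 => [|[|[|[|//]]]] _; rewrite /t /=; last 3 first.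
  - by rewrite divr_ge0 // ler0z mulr_ge0 // ltW.
  - by rewrite divr_ge0 // ler0z mulr_ge0 // ltW.
  - by rewrite divr_ge0 // ler0z mulr_ge0 // ltW.
  have [->|N_neq0] := eqVneq N 0; first by rewrite invr0 mulr0 subr0 ler01.
  by rewrite subr_ge0 ler_pdivrMr ?mul1r ?ler_int // ltr0z lt0r N_neq0.
exists t; first split=> //.
  rewrite /= !big_ord_recl big_ord0 /= /t /= /comb !intrD; ring.
apply/sumE; rewrite /t /=.
(* If [N] is 0, the bound on [comb] makes all three summands vanish. *)
have [N_eq0|N_neq0] := eqVneq N 0; last by rewrite !divfK ?intr_eq0.
have hx : 0 <= v 0 0 * (p * q) by rewrite mulr_ge0 // ltW.
have hy : 0 <= v 0 1 * (p * r) by rewrite mulr_ge0 // ltW.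
have hz : 0 <= v 0 2%:R * (q * r) by rewrite mulr_ge0 // ltW.
have [-> -> ->] : [/\ v 0 0 * (p * q) = 0, v 0 1 * (p * r) = 0
    & v 0 2%:R * (q * r) = 0].
  by move: le_N; rewrite -/N N_eq0 /comb; split; lia.
by rewrite !mul0r.
Qed.

(** * Digit expansions and the values of [Delta] *)

Hypotheses (pq : coprimez p q) (pr : coprimez p r) (qr : coprimez q r).

(** Modulo [r] only the term of [x] survives, and [p * q] is a unit there; likewise for [y] and
    [z]. *)
Lemma digits_uniq {x y z k x' y' z' k'} :
  digits x y z -> digits x' y' z' ->
  comb p q r x y z + k * (p * q * r) = comb p q r x' y' z' + k' * (p * q * r) ->
  [/\ x = x', y = y' & z = z'].
Proof.
move=> [hx hy hz] [hx' hy' hz']; rewrite /comb => E; split.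
- apply: (@coprimez_cancel_small r (p * q)) => //.
    by rewrite coprimezMr coprimez_sym pr coprimez_sym qr.
  apply/dvdzP; exists ((y' - y) * p + (z' - z) * q + (k' - k) * (p * q)); lia.
- apply: (@coprimez_cancel_small q (p * r)) => //.
    by rewrite coprimezMr coprimez_sym pq qr.
  apply/dvdzP; exists ((x' - x) * p + (z' - z) * r + (k' - k) * (p * r)); lia.
- apply: (@coprimez_cancel_small p (q * r)) => //.
    by rewrite coprimezMr pq pr.
  apply/dvdzP; exists ((x' - x) * q + (y' - y) * r + (k' - k) * (q * r)); lia.
Qed.

Lemma Delta_digits (n : nat) : exists x y z, digits x y z /\
  n%:Z = comb p q r x y z + (Delta p q r n - 1) * (p * q * r).
Proof.
have := seifertP p1 q1 r1 pq pr qr; rewrite /Delta.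
case: (seifert p q r) => [[[e p'] q'] r'] [E /andP[p'1 _] /andP[q'1 _] /andP[r'1 _]].
(* Otherwise the Seifert sum would be positive. This turns the absolute value of [e] into [- e]. *)
have e0 : e <= 0.
  rewrite leNgt; apply/negP => e0.
  have : 0 < e * p * q * r by rewrite !mulr_gt0 //; lia.
  have : 0 < p' * q * r by rewrite !mulr_gt0 //; lia.
  have : 0 < p * q' * r by rewrite !mulr_gt0 //; lia.
  have : 0 < p * q * r' by rewrite !mulr_gt0 //; lia.
  lia.
exists (- (n%:Z * r') %% r)%Z, (- (n%:Z * q') %% q)%Z, (- (n%:Z * p') %% p)%Z.
split; first by split; rewrite modz_ge0 ?ltz_pmod //; lia.
rewrite !ceil_divzN ?ler0_norm //; try lia.
have Ep := divz_eq (- (n%:Z * p')) p.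
have Eq := divz_eq (- (n%:Z * q')) q.
have Er := divz_eq (- (n%:Z * r')) r.
rewrite /comb.
(* This is the Seifert equation times [- n]. Dividing with remainder then gives the digits as
   remainders and the negated ceilings as quotients. *)
transitivity (- (n%:Z * e) * (p * q * r) + - (n%:Z * p') * (q * r)
  + - (n%:Z * q') * (p * r) + - (n%:Z * r') * (p * q)).
  rewrite -[LHS]opprK -mulrN1 -E; ring.
rewrite {1}Ep {1}Eq {1}Er; ring.
Qed.

(** The digit part stays below [3 * (p * q * r)], so [Delta p q r n <= -2] would make [n]
    negative. *)
Lemma Delta_geN1 (n : nat) : -1 <= Delta p q r n.
Proof.
have [x [y [z [[hx hy hz] E]]]] := Delta_digits n.
rewrite leNgt; apply/negP => D.
have P0 : 0 < p * q * r by rewrite mulr_gt0 //; lia.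
have : 0 <= (-2 - Delta p q r n) * (p * q * r) by rewrite mulr_ge0 //; lia.
have : 0 <= (r - 1 - x) * (p * q) by rewrite mulr_ge0 //; lia.
have : 0 <= (q - 1 - y) * (p * r) by rewrite mulr_ge0 //; lia.
have : 0 <= (p - 1 - z) * (q * r) by rewrite mulr_ge0 //; lia.
move: E; rewrite /comb; lia.
Qed.

Lemma Delta_eqN1P (n : nat) : Delta p q r n = -1 <->
  exists x y z : nat, n%:Z = N0 p q r - comb p q r x y z.
Proof.
have [x [y [z [[hx hy hz] E]]]] := Delta_digits n; split=> [D | [a [b [c nE]]]].
  (* [N0 p q r] has all digits maximal and coefficient [-2] at [p * q * r], so subtracting [n]
     leaves the complementary digits. *)
  exists `|(r - 1 - x)%R|%N, `|(q - 1 - y)%R|%N, `|(p - 1 - z)%R|%N.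
  rewrite E D /comb /N0 !gez0_abs; try lia.
(* Since [n >= 0], the combination is at most [N0 p q r]. The complements of [a], [b], [c] are then
   the digits of [n], and comparing coefficients gives [Delta p q r n - 1 = -2]. *)
have [ha hb hc] : digits a b c by apply: digits_le_N0 => //; lia.
have E' : comb p q r x y z + (Delta p q r n - 1) * (p * q * r)
        = comb p q r (r - 1 - a%:Z) (q - 1 - b%:Z) (p - 1 - c%:Z)
          + (-2) * (p * q * r).
  by rewrite -E nE /comb /N0; ring.
have [||xE yE zE] := digits_uniq _ _ E'; try by split; lia.
move: E'; rewrite xE yE zE => /addrI /mulIf.
suff -> : p * q * r != 0 by move/(_ isT); lia.
by rewrite gt_eqF // mulr_gt0 //; lia.
Qed.

Lemma card_Delta_eqN1 : [set n | Delta p q r n = -1] #= `I_(kappa p q r).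
Proof.
set D := [set n | _].
have finD : finite_set D.
  apply: sub_finite_set (finite_support_Delta p1 q1 r1 pq pr qr) => n /= ->.
  by [].
(* The summand is 0 off [D] and [-1] on it, so the sum is minus the cardinality of [D]. *)
rewrite /kappa -(fsbig_widen D); last 2 first.
- by [].
- move=> n [_ /= nD]; apply/min_idPl.
  have := Delta_geN1 n; move: nD; rewrite /D /=; lia.
rewrite (eq_fsbigr (fun=> -1)); last by move=> n /set_mem /= ->.
rewrite fsbig_finite //= big_const_seq count_predT iter_addr_0 mulNrn abszN natz.
rewrite absz_nat.
case/finite_setP: (finD) => m Dm; rewrite (card_fset_set Dm); exact: Dm.
Qed.

Lemma card_comb_le_N0 :
  [set m | m <= N0 p q r /\ exists x y z : nat, m = comb p q r x y z]
  #= `I_(kappa p q r).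
Proof.
set E := [set m | _].
apply: card_eq_trans card_Delta_eqN1; rewrite card_eq_sym.
(* On [E] the difference is nonnegative, so the absolute value keeps the reflection injective. *)
have -> : [set n | Delta p q r n = -1] = [set `|(N0 p q r - m)%R|%N | m in E].
  apply/seteqP; split=> [n /= /Delta_eqN1P[x [y [z nE]]] | _ [m [le_m mE] <-] /=].
    exists (comb p q r x y z); last lia.
    by split; [lia | exists x, y, z].
  apply/Delta_eqN1P; case: mE => x [y [z mE]]; exists x, y, z; lia.
by apply: inj_card_eq => a b /set_mem[ha _] /set_mem[hb _] /=; lia.
Qed.

End Brieskorn.

Theorem theorem1p11 (R : realType) (p q r : int)
  (p_gt1 : 1 < p) (p_lt_q : p < q) (q_lt_r : q < r)
  (coprime_pq : coprimez p q) (coprime_pr : coprimez p r)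
  (coprime_qr : coprimez q r) :
  lattice_points (tetrahedron R p q r) #= `I_(kappa p q r)
  /\ G (p * q) (p * r) (q * r) `&` `[0, N0 p q r] #= `I_(kappa p q r).
Proof.
have q_gt1 : 1 < q by lia.
have r_gt1 : 1 < r by lia.
have := card_comb_le_N0 _ _ _ p_gt1 q_gt1 r_gt1 coprime_pq coprime_pr coprime_qr.
set E := [set m | _] => cardE; split; apply: card_eq_trans cardE.
  have latticeP := lattice_points_tetrahedron _ _ _ p_gt1 q_gt1 r_gt1 R.
  have -> : E = [set comb p q r (v 0 0) (v 0 1) (v 0 2%:R) |
                  v in lattice_points (tetrahedron R p q r)].
    apply/seteqP; split=> [m [le_m [x [y [z mE]]]] | _ [v hv <-]].
      exists (\row_j nth 0 [:: x%:Z; y%:Z; z%:Z] j); last by rewrite !mxE.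
      by apply/latticeP; rewrite !mxE /= -mE; split.
    case/latticeP: hv => x0 y0 z0 le_N; split=> //.
    by exists `|(v 0 0)%R|%N, `|(v 0 1)%R|%N, `|(v 0 2%:R)%R|%N; rewrite !gez0_abs.
  rewrite card_eq_sym; apply: inj_card_eq => u v.
  move=> /set_mem/latticeP[ux uy uz u_le] /set_mem/latticeP[vx vy vz v_le] uvE.
  (* Coordinates of lattice points are digits, so uniqueness with both coefficients of [p * q * r]
     equal to 0 makes [comb] injective on them. *)
  have u_dig : digits p q r (u 0 0) (u 0 1) (u 0 2%:R) by exact: digits_le_N0.
  have v_dig : digits p q r (v 0 0) (v 0 1) (v 0 2%:R) by exact: digits_le_N0.
  have [] := @digits_uniq _ _ _ p_gt1 q_gt1 r_gt1 coprime_pq coprime_pr coprime_qr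
    _ _ _ 0 _ _ _ 0 u_dig v_dig; first by rewrite uvE.
  by move=> *; apply/rowP => j; have [->|->|->] := ord3P j.
rewrite G_comb.
(* The lower end of the interval is automatic, combinations being nonnegative. *)
have -> : [set m | exists x y z : nat, m = comb p q r x y z]
    `&` `[0, N0 p q r] = E.
  apply/seteqP; split=> [m [mE] | m [le_m mE]] /=; rewrite in_itv /=.
    by case/andP.
  split=> //; rewrite le_m andbT.
  by case: mE => x [y [z ->]]; rewrite !addr_ge0 // mulr_ge0 // mulr_ge0 //; lia.
exact: card_eqxx.
Qed.
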